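(* Let $n\ge 1$ and $1\le k\le n$. The operator space $H_n^k$ is homogeneous; that is, every bounded linear map $T:H_n^k\to H_n^k$ is completely bounded and satisfies $\|T\|_{\mathrm{cb}}=\|T\|$.
   Context: Definition of $H_n^k$. Let $1\le k\le n$. Let $I=\{i_1<\cdots<i_{k-1}\}$ range over the subsets of $\{1,\ldots,n\}$ of cardinality $k-1$ (there are $q=\binom{n}{k-1}$ of them) and $J=\{j_1<\cdots<j_{n-k}\}$ over the subsets of cardinality $n-k$ (there are $p=\binom{n}{n-k}$ of them), each collection ordered lexicographically. Let $\{e_I\}$ and $\{e_J\}$ be the canonical bases of column vectors of $\mathbf{C}^q$ and $\mathbf{C}^p$, indexed by these subsets, and let $e_{J,I}=e_Je_I^t\in M_{p,q}(\mathbf{C})=B(\mathbf{C}^q,\mathbf{C}^p)$. For $1\le i\le n$ put $$b_i^{n,k}=\sum_{I\cap J=\emptyset,\ (I\cup J)^c=\{i\}}\epsilon(I,i,J)\,e_{J,I},$$ where $\epsilon(I,i,J)$ is the signature of the permutation taking $(i_1,\ldots,i_{k-1},i,j_1,\ldots,j_{n-k})$ to $(1,\ldots,n)$. Then $H_n^k$ is the linear span of $b_1^{n,k},\ldots,b_n^{n,k}$, with the operator space structure inherited from $B(\mathbf{C}^q,\mathbf{C}^p)$. It is isometric to an $n$-dimensional Hilbert space with orthonormal basis $b_1^{n,k},\ldots,b_n^{n,k}$. *)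

(* Defs.v *)
From mathcomp Require Import all_boot all_order all_algebra all_fingroup.
From mathcomp Require Import complex.
From mathcomp Require Import all_classical all_reals all_analysis.

Set Implicit Arguments.
Unset Strict Implicit.
Unset Printing Implicit Defensive.

Import Order.TTheory GRing.Theory Num.Theory.
Local Open Scope ring_scope.

(* Norms take values in \bar R, so that every supremum below is a genuine one
   and boundedness of a map is finiteness of its norm. *)

Definition opnorm (R : realType) (V W : Type) (NV : V -> \bar R)
    (NW : W -> \bar R) (f : V -> W) : \bar R :=
  ereal_sup [set NW (f x) | x in [set x | (NV x <= 1)%E]]%classic.

Definition l2norm (R : realType) (m : nat) (v : 'cV[R[i]]_m) : \bar R :=
  (Num.sqrt (\sum_(i < m) ComplexField.Normc.normc (v i 0) ^+ 2))%:E.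

(* The norm of B(C^q, C^p), with C^q and C^p Hilbertian; this is not the
   max-norm with which the library equips matrices. *)
Definition mxopnorm (R : realType) (p q : nat) (A : 'M[R[i]]_(p, q)) : \bar R :=
  opnorm (@l2norm R q) (@l2norm R p) (fun v => A *m v).

(* A concrete operator space is a subspace E of B(C^q, C^p) = M_{p,q}(C). *)

Definition subnorm (R : realType) (p q : nat) (E : {vspace 'M[R[i]]_(p, q)})
    (x : subvs_of E) : \bar R :=
  mxopnorm (vsval x).

(* The norm on M_m(E) inherited from
   M_m(B(C^q, C^p)) = B((C^q)^m, (C^p)^m). *)
Definition ampnorm (R : realType) (p q : nat) (E : {vspace 'M[R[i]]_(p, q)})
    (m : nat) (x : 'M[subvs_of E]_m) : \bar R :=
  mxopnorm (\mxblock_(i < m, j < m) vsval (x i j)).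

Definition mapnorm (R : realType) (p q : nat) (E : {vspace 'M[R[i]]_(p, q)})
    (T : subvs_of E -> subvs_of E) : \bar R :=
  opnorm (@subnorm R p q E) (@subnorm R p q E) T.

Definition cbnorm (R : realType) (p q : nat) (E : {vspace 'M[R[i]]_(p, q)})
    (T : subvs_of E -> subvs_of E) : \bar R :=
  ereal_sup [set opnorm (@ampnorm R p q E m) (@ampnorm R p q E m) (map_mx T)
            | m in [set m : nat | (0 < m)%N]]%classic.

Definition bounded_map (R : realType) (p q : nat)
    (E : {vspace 'M[R[i]]_(p, q)}) (T : subvs_of E -> subvs_of E) : Prop :=
  (mapnorm T < +oo)%E.

Definition completely_bounded (R : realType) (p q : nat)
    (E : {vspace 'M[R[i]]_(p, q)}) (T : subvs_of E -> subvs_of E) : Prop :=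
  (cbnorm T < +oo)%E.

Definition homogeneous (R : realType) (p q : nat)
    (E : {vspace 'M[R[i]]_(p, q)}) : Prop :=
  forall T : {linear subvs_of E -> subvs_of E},
    bounded_map T -> completely_bounded T /\ cbnorm T = mapnorm T.

(* The ground set {1, ..., n} is 'I_n; for A : {set 'I_n}, [enum A] lists A in
   increasing order. *)

Definition lexsets (n m : nat) : seq {set 'I_n} :=
  sort (fun A B : {set 'I_n} =>
          ((enum A : seqlexi 'I_n) <= (enum B : seqlexi 'I_n))%O)
       (enum [set A : {set 'I_n} | #|A| == m]).

Definition lexset (n m : nat) (a : 'I_('C(n, m))) : {set 'I_n} :=
  nth finset.set0 (lexsets n m) a.
Arguments lexset : clear implicits.

(* The signature of the permutation s with s (w_j) = j for all j, where
   w = (I, i, J); there is exactly one such s when I, {i}, J partition the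
   ground set, which is the only case used below. *)
Definition eps (R : realType) (n : nat) (I : {set 'I_n}) (i : 'I_n)
    (J : {set 'I_n}) : R[i] :=
  if [pick s : 'S_n | [forall j : 'I_n,
        s (nth i (enum I ++ i :: enum J) j) == j]] is Some s
  then (-1) ^+ odd_perm s else 0.

(* The row index b stands for J and the column index a for I, so that
   [delta_mx b a] is e_J e_I^t. *)
Definition bvec (R : realType) (n k : nat) (i : 'I_n) :
    'M[R[i]]_('C(n, n - k), 'C(n, k.-1)) :=
  \sum_(b < 'C(n, n - k)) \sum_(a < 'C(n, k.-1)
      | (lexset n k.-1 a :&: lexset n (n - k) b == finset.set0) &&
        (~: (lexset n k.-1 a :|: lexset n (n - k) b) == [set i]%SET))
    eps R (lexset n k.-1 a) i (lexset n (n - k) b) *: delta_mx b a.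

Definition Hspace (R : realType) (n k : nat) :
    {vspace 'M[R[i]]_('C(n, n - k), 'C(n, k.-1))} :=
  <<[seq bvec R k i | i <- enum 'I_n]>>%VS.

(* Main.v *)
(* For h in C^n, let b(h) = sum_i h_i b_i. Its (J, I) entry is the determinant
   with rows e_I, h, e_J, so multiplicativity of the determinant and two Laplace
   expansions give det(U) b(h) = C(U) b(h U) C(U)^T, with C(U) the compound
   matrices (all minors) of U. By Cauchy-Binet these are unitary when U is, so
   every unitary U acts on H_n^k by a complete isometry.

   If M is invertible and b(h) |-> b(h M) has norm at most c, the polar
   decomposition gives M = Q^* D W with Q, W unitary and D diagonal positive;
   unitary invariance forces D <= c, so D / c is the average of a diagonal unitary
   and its adjoint, and M / c is the average of two unitaries. Hence the cb-norm is
   at most c. A singular M is approximated by invertible M + e. *)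
Require Import Defs.
From HB Require Import structures.
From mathcomp Require Import all_boot all_order all_algebra all_fingroup.
From mathcomp Require Import complex.
From mathcomp Require Import all_classical all_reals all_analysis.

Set Implicit Arguments.
Unset Strict Implicit.
Unset Printing Implicit Defensive.

Import Order.TTheory GRing.Theory Num.Theory.
Local Open Scope ring_scope.

(** * Words, alternating forms and compound matrices *)

Lemma size_lexsets n m : size (lexsets n m) = 'C(n, m).
Proof. by rewrite size_sort -cardE card_draws card_ord. Qed.

Lemma card_lexset n m (I : 'I_('C(n, m))) : #|lexset n m I| = m.
Proof.
have : lexset n m I \in lexsets n m by rewrite mem_nth ?size_lexsets.
by rewrite mem_sort mem_enum inE => /eqP.
Qed.

Lemma lexset_inj n m : injective (lexset n m).
Proof.
move=> I J /eqP; rewrite nth_uniq ?size_lexsets //; first by move/eqP/val_inj.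
by rewrite sort_uniq enum_uniq.
Qed.

Lemma lexset_onto n m (A : {set 'I_n}) : #|A| = m ->
  exists I, lexset n m I = A.
Proof.
move=> cA; have : A \in lexsets n m by rewrite mem_sort mem_enum inE cA.
move=> hA; have := hA; rewrite -index_mem size_lexsets => h.
by exists (Ordinal h); rewrite /lexset nth_index.
Qed.

(** A function out of ['I_m], so that [mxsub], [rowsub] and [colsub] can cut out minors with it. *)
Definition lexword n m (I : 'I_('C(n, m))) (j : 'I_m) : 'I_n :=
  enum_val (cast_ord (esym (card_lexset I)) j).

Lemma lexwordE n m (I : 'I_('C(n, m))) x0 (j : 'I_m) :
  lexword I j = nth x0 (enum (lexset n m I)) j.
Proof. exact: enum_val_nth. Qed.

Lemma lexword_inj n m (I : 'I_('C(n, m))) : injective (lexword I).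
Proof. by move=> i j /enum_val_inj/cast_ord_inj. Qed.

Lemma lexword_mem n m (I : 'I_('C(n, m))) j : lexword I j \in lexset n m I.
Proof. exact: enum_valP. Qed.

Lemma lexword_onto n m (I : 'I_('C(n, m))) x : x \in lexset n m I ->
  exists j, lexword I j = x.
Proof.
move=> hx; exists (cast_ord (card_lexset I) (enum_rank_in hx x)).
by rewrite /lexword cast_ordK enum_rankK_in.
Qed.

Section Alternating.
Variables (R : comNzRingType) (m n : nat).
Implicit Types (A : 'M[R]_(m, n)) (D : 'M[R]_(m, n) -> R).

Definition wordmx (t : 'I_m -> 'I_n) : 'M[R]_(m, n) :=
  \matrix_(j, x) (t j == x)%:R.

Lemma mul_wordmx p (t : 'I_m -> 'I_n) (B : 'M[R]_(n, p)) :
  wordmx t *m B = rowsub t B.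
Proof.
apply/matrixP=> i j; rewrite !mxE (bigD1 (t i)) //= mxE eqxx mul1r big1 ?addr0 //.
by move=> x; rewrite mxE eq_sym => /negPf->; rewrite mul0r.
Qed.

(** Multilinearity in the rows, in the one form used later: expand every row in the canonical basis
    and sum over all words. *)
Definition word_expansion D := forall A,
  D A = \sum_(t : {ffun 'I_m -> 'I_n}) (\prod_j A j (t j)) * D (wordmx t).

Definition alternating D :=
  (forall (s : 'S_m) A, D (row_perm s A) = (-1) ^+ s * D A) /\
  (forall A i1 i2, i1 != i2 -> A i1 =1 A i2 -> D A = 0).

(** In a formula taking one entry from each row, the product at [wordmx t] is 1 when [t] is the word
    [phi s] and 0 otherwise. *)
Lemma leibniz_expansion (S : finType) (c : S -> R) (phi : S -> 'I_m -> 'I_n) D :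
  (forall A, D A = \sum_s c s * \prod_j A j (phi s j)) -> word_expansion D.
Proof.
move=> DE A; rewrite DE.
under [RHS]eq_bigr => t _ do rewrite DE mulr_sumr.
rewrite exchange_big /=; apply: eq_bigr => s _.
rewrite [RHS](bigD1 [ffun j => phi s j]) //= [X in _ + X]big1 ?addr0.
  rewrite mulrCA -big_split /=; congr (_ * _); apply: eq_bigr => j _.
  by rewrite mxE ffunE eqxx mulr1.
move=> t /eqP tN; suff [j tj] : exists j, t j != phi s j.
  by rewrite (bigD1 (P := predT) (F := fun j => wordmx t j _) j) //= mxE (negPf tj)
    mul0r !mulr0.
apply/existsP; rewrite -negb_forall; apply/negP => /forallP tE; apply: tN.
by apply/ffunP=> j; rewrite ffunE; exact/eqP.
Qed.

(** By the word expansion only words matter. On a word with a repetition both sides vanish. An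
    injective word is a permutation of the increasing word of its image [I0], and its minors at all
    other sets have a zero row. *)
Lemma alternating_expand D : word_expansion D -> alternating D ->
  forall A, D A =
    \sum_(I < 'C(n, m)) \det (colsub (lexword I) A) * D (wordmx (lexword I)).
Proof.
move=> Dw [Dp Da] A.
have detw (I : 'I_('C(n, m))) (t : {ffun 'I_m -> 'I_n}) j :
    t j \notin lexset n m I -> \det (colsub (lexword I) (wordmx t)) = 0.
  move=> tj; rewrite (expand_det_row _ j) big1 // => x _; rewrite !mxE.
  case: eqP => [tE|]; last by rewrite mul0r.
  by move: tj; rewrite tE lexword_mem.
have Dt (t : {ffun 'I_m -> 'I_n}) : D (wordmx t) =
    \sum_(I < 'C(n, m))
      \det (colsub (lexword I) (wordmx t)) * D (wordmx (lexword I)).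
  case: (boolP (injectiveb t)) =>
      [/injectiveP tI|/injectivePn[i1 [i2 i12 t12]]]; last first.
    rewrite (Da _ _ _ i12); last by move=> x; rewrite !mxE t12.
    rewrite big1 // => I _; rewrite (determinant_alternate i12) ?mul0r //.
    by move=> x; rewrite !mxE t12.
  have [|I0 I0E] := @lexset_onto n m [set t j | j in 'I_m]%SET.
    by rewrite card_imset // card_ord.
  have tmem j : t j \in lexset n m I0 by rewrite I0E imset_f.
  rewrite (bigD1 I0) //= big1 ?addr0; last first.
    move=> I IN; suff [j jN] : exists j, t j \notin lexset n m I.
      by rewrite (detw _ _ j) ?mul0r.
    apply/existsP; rewrite -negb_forall; apply: contra IN => /forallP tI'.
    apply/eqP/lexset_inj/eqP; rewrite eq_sym eqEcard !card_lexset leqnn andbT I0E.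
    by apply/fintype.subsetP => _ /imsetP[j _ ->].
  have /boolp.choice[f fE] : forall j, exists i, lexword I0 i = t j.
    by move=> j; apply: lexword_onto.
  have fI : injective f by move=> i j fij; apply: tI; rewrite -!fE fij.
  have -> : wordmx t = row_perm (perm fI) (wordmx (lexword I0)).
    by apply/matrixP=> i j; rewrite !mxE permE fE.
  rewrite Dp; congr (_ * _).
  rewrite -[colsub _ _]mulmx1.
  suff -> : colsub (lexword I0) (row_perm (perm fI) (wordmx (lexword I0)))
     = perm_mx (perm fI) by rewrite mulmx1 det_perm.
  by apply/matrixP=> i j; rewrite !mxE (inj_eq (@lexword_inj _ _ _)).
rewrite Dw; under eq_bigr => t _ do rewrite Dt mulr_sumr.
rewrite exchange_big /=; apply: eq_bigr => I _.
under eq_bigr do rewrite mulrA; rewrite -mulr_suml; congr (_ * _).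
(* What is left is the word expansion of the minor at [I], read backwards. *)
rewrite -(@leibniz_expansion 'S_m (fun s => (-1) ^+ s) (fun s j => lexword I (s j))
  (fun A => \det (colsub (lexword I) A))) // => B.
by apply: eq_bigr => s _; congr (_ * _); apply: eq_bigr => j _; rewrite mxE.
Qed.

End Alternating.

(** * Compound matrices and the Cauchy-Binet formula *)

Section Compound.
Variable (R : comNzRingType).

Definition compound m n (U : 'M[R]_n) : 'M[R]_('C(n, m)) :=
  \matrix_(I, J) \det (mxsub (@lexword n m I) (@lexword n m J) U).

(** As a function of [A] the left side is multilinear and alternating, and its value at e_I is the
    minor of [B] with rows [I]. *)
Lemma cauchy_binet m n (A : 'M[R]_(m, n)) (B : 'M[R]_(n, m)) :
  \det (A *m B) = \sum_(I < 'C(n, m))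
    \det (colsub (lexword I) A) * \det (rowsub (lexword I) B).
Proof.
rewrite (@alternating_expand _ _ _ (fun A => \det (A *m B))).
- by apply: eq_bigr => I _; rewrite mul_wordmx.
(* The Leibniz formula with each entry of [A *m B] multiplied out: [s] is the permutation and [t]
   picks the summation index in each row. *)
- apply: (@leibniz_expansion _ _ _ ('S_m * {ffun 'I_m -> 'I_n})%type
    (fun st => (-1) ^+ st.1 * \prod_j B (st.2 j) (st.1 j)) (fun st => st.2)) => {}A.
  rewrite -(pair_bigA _ (fun (s : 'S_m) (t : {ffun 'I_m -> 'I_n}) =>
     (-1) ^+ s * (\prod_j B (t j) (s j)) * \prod_j A j (t j))) /=.
  apply: eq_bigr => s _.
  under [in LHS]eq_bigr do rewrite mxE.
  rewrite bigA_distr_bigA /= mulr_sumr; apply: eq_bigr => t _.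
  by rewrite big_split /= -mulrA [in LHS](mulrC (\prod_i A _ _)).
- split=> [s {}A|{}A i1 i2 i12 A12].
    by rewrite row_permE -mulmxA det_mulmx det_perm.
  apply: (determinant_alternate i12) => j; rewrite !mxE.
  by apply: eq_bigr => x _; rewrite A12.
Qed.

Lemma compoundM m n (U V : 'M[R]_n) :
  compound m (U *m V) = compound m U *m compound m V.
Proof.
apply/matrixP=> I J; rewrite !mxE.
have -> : mxsub (lexword I) (lexword J) (U *m V) =
   rowsub (lexword I) U *m colsub (lexword J) V.
  by apply/matrixP=> i j; rewrite !mxE; apply: eq_bigr => x _; rewrite !mxE.
rewrite cauchy_binet; apply: eq_bigr => K _; rewrite !mxE.
by congr (_ * _); congr (\det _); apply/matrixP=> i j; rewrite !mxE.
Qed.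

Lemma compound1 m n : compound m (1%:M : 'M[R]_n) = 1%:M.
Proof.
apply/matrixP=> I J; rewrite !mxE; case: (eqVneq I J) => [->|IJ].
  suff -> : mxsub (lexword J) (lexword J) 1%:M = 1%:M :> 'M[R]_m by rewrite det1.
  by apply/matrixP=> i j; rewrite !mxE (inj_eq (@lexword_inj _ _ _)).
(* Distinct sets of equal size are not nested, so some row of the minor is zero. *)
suff [j jN] : exists j, lexword I j \notin lexset n m J.
  rewrite (expand_det_row _ j) big1 // => x _; rewrite !mxE.
  case: eqP => [tE|]; last by rewrite mul0r.
  by move: jN; rewrite tE lexword_mem.
apply/existsP; rewrite -negb_forall; apply: contra IJ => /forallP tI'.
apply/eqP/lexset_inj/eqP; rewrite eqEcard !card_lexset leqnn andbT.
by apply/fintype.subsetP => x /lexword_onto[j <-].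
Qed.

Lemma tr_compound m n (U : 'M[R]_n) : (compound m U)^T = compound m U^T.
Proof. apply/matrixP=> I J; rewrite !mxE -det_tr; congr (\det _).
by apply/matrixP=> i j; rewrite !mxE. Qed.

End Compound.

Lemma map_compound (R S : comNzRingType) (f : {rmorphism R -> S}) m n (U : 'M[R]_n) :
  map_mx f (compound m U) = compound m (map_mx f U).
Proof. by apply/matrixP=> I J; rewrite !mxE -det_map_mx map_mxsub. Qed.

(** * The space as determinants with one free row *)

Section Hilbert.
Variables (R : comNzRingType) (a b : nat).
Notation n := (a + (1 + b))%N.

(** With n written as a + (1 + b), where a = k - 1 and b = n - k, the stacked matrix is square by
    its type. *)
Definition threedet (A : 'M[R]_(a, n)) (h : 'rV[R]_n) (B : 'M[R]_(b, n)) : R :=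
  \det (col_mx A (col_mx h B)).

(** This is b(h), the sum of the h_i b_i. The signs and the disjointness conditions are hidden in
    the determinant; [bmx_delta] recovers them. *)
Definition bmx (h : 'rV[R]_n) : 'M[R]_('C(n, b), 'C(n, a)) :=
  \matrix_(J, I) threedet (wordmx R (lexword I)) h (wordmx R (lexword J)).

Lemma threedetE A h B : threedet A h B = \sum_(s : 'S_n) (-1) ^+ s *
  ((\prod_j A j (s (lshift _ j))) * (h 0 (s (rshift _ (lshift _ 0))) *
   (\prod_j B j (s (rshift _ (rshift _ j)))))).
Proof.
apply: eq_bigr => s _; rewrite !big_split_ord big_ord1 /=.
congr (_ * (_ * (_ * _))).
- by apply: eq_bigr => j _; rewrite col_mxEu.
- by rewrite col_mxEd col_mxEu.
- by apply: eq_bigr => j _; rewrite !col_mxEd.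
Qed.

(** Laplace expansion along the top [a] rows: with the other rows fixed, the determinant is an
    alternating form in [A]. *)
Lemma threedet_expandl A h B : threedet A h B =
  \sum_I \det (colsub (lexword I) A) * threedet (wordmx R (lexword I)) h B.
Proof.
rewrite (@alternating_expand _ _ _ (fun A => threedet A h B)) //.
  apply: (@leibniz_expansion _ _ _ 'S_n (fun s => (-1) ^+ s *
    (h 0 (s (rshift _ (lshift _ 0))) * (\prod_j B j (s (rshift _ (rshift _ j))))))
    (fun s j => s (lshift _ j))) => {}A.
  rewrite threedetE; apply: eq_bigr => s _.
  by rewrite -[RHS]mulrA; congr (_ * _); exact: mulrC.
split=> [s {}A|{}A i1 i2 i12 A12].
  rewrite /threedet.
  have -> : col_mx (row_perm s A) (col_mx h B) =
     block_mx (perm_mx s) 0 0 1%:M *m col_mx A (col_mx h B).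
    by rewrite mul_block_col !mul0mx mul1mx addr0 add0r row_permE.
  by rewrite det_mulmx det_ublock det1 det_perm mulr1.
apply: (@determinant_alternate _ _ _ (lshift _ i1) (lshift _ i2)).
  by rewrite (inj_eq (@lshift_inj _ _)).
by move=> j; rewrite !col_mxEu.
Qed.

Lemma threedet_expandr A h B : threedet A h B =
  \sum_J \det (colsub (lexword J) B) * threedet A h (wordmx R (lexword J)).
Proof.
rewrite (@alternating_expand _ _ _ (fun B => threedet A h B)) //.
  apply: (@leibniz_expansion _ _ _ 'S_n (fun s => (-1) ^+ s *
    (\prod_j A j (s (lshift _ j)) * h 0 (s (rshift _ (lshift _ 0)))))
    (fun s j => s (rshift _ (rshift _ j)))) => {}B.
  by rewrite threedetE; apply: eq_bigr => s _; rewrite !mulrA.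
split=> [s {}B|{}B i1 i2 i12 B12].
  rewrite /threedet.
  have -> : col_mx A (col_mx h (row_perm s B)) =
     block_mx 1%:M 0 0 (block_mx 1%:M 0 0 (perm_mx s)) *m col_mx A (col_mx h B).
    by rewrite !mul_block_col !mul0mx !mul1mx !addr0 !add0r row_permE.
  by rewrite det_mulmx !det_ublock !det1 det_perm !mul1r.
apply: (@determinant_alternate _ _ _ (rshift _ (rshift _ i1)) (rshift _ (rshift _ i2))).
  by rewrite !(inj_eq (@rshift_inj _ _)).
by move=> j; rewrite !col_mxEd.
Qed.

Lemma threedetM A h B U :
  threedet (A *m U) (h *m U) (B *m U) = \det U * threedet A h B.
Proof. by rewrite /threedet -!mul_col_mx det_mulmx mulrC. Qed.

(** Laplace expansion at both ends: [bmx h] is the matrix of a bilinear form in the minors of [B]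
    and those of [A]. *)
Lemma threedet_bmx A h B : threedet A h B =
  \sum_J \sum_I \det (colsub (lexword J) B) * (bmx h J I *
    \det (colsub (lexword I) A)).
Proof.
rewrite threedet_expandr; apply: eq_bigr => J _.
rewrite threedet_expandl mulr_sumr; apply: eq_bigr => I _.
by rewrite mxE; congr (_ * _); exact: mulrC.
Qed.

(** An entry of the left side is the determinant with rows e_I U, h U, e_J U, and the minors of e_I
    U and e_J U are rows of the compound matrices. *)
Lemma bmx_covariant (h : 'rV[R]_n) (U : 'M[R]_n) :
  \det U *: bmx h = compound b U *m bmx (h *m U) *m (compound a U)^T.
Proof.
apply/matrixP=> J I; rewrite !mxE -threedetM threedet_bmx exchange_big /=.
apply: eq_bigr => I' _; rewrite !mxE mulr_suml; apply: eq_bigr => J' _.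
rewrite mulrA !mxE !mul_wordmx; congr (_ * _ * _); congr (\det _).
  by apply/matrixP=> i j; rewrite !mxE.
by apply/matrixP=> i j; rewrite !mxE.
Qed.

Lemma bmxE h : bmx h = \sum_i h 0 i *: bmx (delta_mx 0 i).
Proof.
apply/matrixP=> J I; rewrite summxE mxE threedetE.
under [RHS]eq_bigr => i _ do rewrite !mxE threedetE mulr_sumr.
rewrite exchange_big /=; apply: eq_bigr => s _.
set x := s _; rewrite [RHS](bigD1 x) //= mxE !eqxx mul1r [X in _ + X]big1 ?addr0.
  by rewrite [RHS]mulrCA; congr (_ * _); rewrite mulrCA.
by move=> i; rewrite mxE andTb eq_sym => /negPf ->; rewrite mul0r !mulr0.
Qed.

Lemma bmx_is_linear : linear bmx.
Proof.
move=> c h g; rewrite !bmxE scaler_sumr -big_split /=; apply: eq_bigr => i _.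
by rewrite !mxE scalerDl scalerA.
Qed.

HB.instance Definition _ :=
  GRing.isLinear.Build R 'rV[R]_n 'M[R]_('C(n, b), 'C(n, a)) *:%R bmx bmx_is_linear.

End Hilbert.

(** The stacked matrix is the word matrix of (I, i, J): a permutation matrix if no letter repeats,
    and a matrix with two equal rows otherwise. *)
Lemma threedet_eps (R : realType) a b (i : 'I_(a + (1 + b)))
    (I : 'I_('C(a + (1 + b), a))) (J : 'I_('C(a + (1 + b), b))) :
  threedet (wordmx R[i] (lexword I)) (delta_mx 0 i) (wordmx R[i] (lexword J)) =
  if (lexset _ a I :&: lexset _ b J == finset.set0) &&
     (~: (lexset _ a I :|: lexset _ b J) == [set i]%SET)
  then eps R (lexset _ a I) i (lexset _ b J) else 0.
Proof.
set n := (a + (1 + b))%N in i I J *.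
set A := lexset _ _ I; set B := lexset _ _ J.
have sA : size (enum A) = a by rewrite -cardE card_lexset.
have sB : size (enum B) = b by rewrite -cardE card_lexset.
pose s := enum A ++ i :: enum B.
have ss : size s = n by rewrite size_cat /= sA sB.
(* The default [i] agrees with the one in [eps]; it is never returned, as [s] has length n. *)
pose w (j : 'I_n) := nth i s j.
have -> : threedet (wordmx R[i] (lexword I)) (delta_mx 0 i)
    (wordmx R[i] (lexword J)) = \det (wordmx R[i] w).
  congr (\det _); apply/matrixP=> j x.
  rewrite [RHS]mxE /w /s nth_cat sA.
  case: (split_ordP j) => [j' ->|j' ->]; rewrite ?col_mxEu ?col_mxEd /=.
    by rewrite mxE (lexwordE _ i).
  rewrite addKn.
  case: (split_ordP j') => [k ->|k ->]; rewrite ?col_mxEu ?col_mxEd /=.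
    by rewrite (ord1 k) mxE /= eq_sym.
  by rewrite mxE (lexwordE _ i).
have us_cond : uniq s -> (A :&: B == finset.set0) && (~: (A :|: B) == [set i]%SET).
  rewrite cat_uniq /= => /and4P[_ /norP[iA AB] iB _].
  rewrite !mem_enum in iA iB.
  have dAB : A :&: B = finset.set0.
    apply/setP => x; rewrite !inE; apply/negP => /andP[xA xB].
    by move/hasPn: AB => /(_ x); rewrite !mem_enum => /(_ xB) /negP.
  (* The complement of the union contains [i] and has n - (a + b) = 1 element. *)
  rewrite dAB eqxx /= eq_sym eqEcard finset.sub1set !inE negb_or iA iB cards1 /=.
  rewrite cardsCs finset.setCK cardsU dAB cards0 subn0 !card_lexset card_ord.
  by rewrite leq_subLR addn1 /n add1n addnS.
have cond_us : (A :&: B == finset.set0) && (~: (A :|: B) == [set i]%SET) -> uniq s.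
  case/andP=> /eqP dAB /eqP cAB.
  have : i \in ~: (A :|: B) by rewrite cAB set11.
  rewrite !inE negb_or => /andP[iA iB].
  rewrite cat_uniq /= !enum_uniq !mem_enum iB (negPf iA) /= andbT.
  apply/hasPn => x; rewrite !mem_enum => xB; apply/negP => xA.
  have : x \in A :&: B by rewrite inE xA xB.
  by rewrite dAB inE.
have uw : uniq s -> injective w.
  by move=> us j k /eqP; rewrite nth_uniq ?ss // => /eqP/val_inj.
case: ifP => cnd.
  have wI := uw (cond_us cnd).
  have wp (t : 'S_n) : (forall j, t (w j) = j) -> wordmx R[i] w = perm_mx t^-1.
    move=> tw; apply/matrixP=> j x; rewrite !mxE -{2}[j]tw permK; congr (_ == _)%:R.
  (* The permutation picked by [eps] is the inverse of [w], so it has the same signature; that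
     inverse is also the witness that the pick succeeds. *)
  rewrite /eps; case: pickP => [t /forallP tw|/(_ (perm wI)^-1%g) /negP[]].
    rewrite (wp t) ?det_perm ?odd_permV // => j; exact/eqP/tw.
  by apply/forallP=> j; rewrite -[nth _ _ _]/(w j) -(permE wI) permK.
have : ~ uniq s by move/us_cond; rewrite cnd.
move/negP/(uniqPn i)=> [j [k [jk ks jkE]]].
rewrite ss in ks.
apply: (@determinant_alternate _ _ _ (Ordinal (ltn_trans jk ks)) (Ordinal ks)).
  by rewrite -val_eqE /= ltn_eqF.
by move=> x; rewrite !mxE /w /= jkE.
Qed.

(** The right side is [bvec] at [i], with [a] for k - 1 and [b] for n - k. *)
Lemma bmx_delta (R : realType) a b (i : 'I_(a + (1 + b))) :
  bmx (delta_mx 0 i) = \sum_(J < 'C(a + (1 + b), b))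
    \sum_(I < 'C(a + (1 + b), a)
      | (lexset _ a I :&: lexset _ b J == finset.set0) &&
        (~: (lexset _ a I :|: lexset _ b J) == [set i]%SET))
    eps R (lexset _ a I) i (lexset _ b J) *: delta_mx J I.
Proof.
apply/matrixP=> J I; rewrite mxE threedet_eps summxE.
rewrite (bigD1 J) //= summxE [X in _ = _ + X]big1 ?addr0; last first.
  move=> J' J'J; rewrite summxE big1 // => I' _.
  by rewrite !mxE eq_sym (negPf J'J) mulr0.
rewrite big_mkcond (bigD1 I) //= [X in _ = _ + X]big1 ?addr0; last first.
  move=> I' I'I; case: ifP => // _.
  by rewrite !mxE eqxx eq_sym (negPf I'I) mulr0.
by case: ifP => // _; rewrite !mxE !eqxx mulr1.
Qed.

(** * Operator norms of complex matrices *)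

Local Open Scope sesquilinear_scope.
Local Notation normc := ComplexField.Normc.normc.

Section OperatorNorm.
Variable R : realType.

Lemma opnorm_le (V W : Type) (NV : V -> \bar R) (NW : W -> \bar R) (f : V -> W) c :
  (forall x, (NV x <= 1)%E -> (NW (f x) <= c)%E) -> (opnorm NV NW f <= c)%E.
Proof. by move=> h; apply/ereal_supP => _ [x x1 <-]; apply: h. Qed.

Lemma opnorm_ub (V W : Type) (NV : V -> \bar R) (NW : W -> \bar R) (f : V -> W) x :
  (NV x <= 1)%E -> (NW (f x) <= opnorm NV NW f)%E.
Proof. by move=> x1; apply: ereal_sup_ubound; exists x. Qed.

(** Rescale [x] to norm one. The norms are abstract because this serves both matrices acting on
    columns and [T] acting on the subspace. *)
Lemma opnorm_mul (V W : lmodType R[i]) (nv : V -> R) (nw : W -> R)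
    (f : {linear V -> W}) (c : R) :
    (forall x, 0 <= nv x) -> (forall x, nv x = 0 -> x = 0) -> nw 0 = 0 ->
    (forall (a : R) x, 0 < a -> nv (a%:C%C *: x) = a * nv x) ->
    (forall (a : R) x, 0 < a -> nw (a%:C%C *: x) = a * nw x) ->
    (opnorm (fun x => (nv x)%:E) (fun y => (nw y)%:E) f <= c%:E)%E ->
  forall x, nw (f x) <= c * nv x.
Proof.
move=> nv0 nv_eq0 nw0 nvZ nwZ fc x.
have [nvx|nvx] := eqVneq (nv x) 0.
  by rewrite (nv_eq0 _ nvx) linear0 nw0 -(nv_eq0 _ nvx) nvx mulr0.
have px : 0 < nv x by rewrite lt_def nvx nv0.
have := @opnorm_ub _ _ (fun x => (nv x)%:E) (fun y => (nw y)%:E) f ((nv x)^-1%:C%C *: x).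
rewrite nvZ ?invr_gt0 // mulVf // => /(_ (lexx _)) /le_trans /(_ fc).
by rewrite linearZ /= nwZ ?invr_gt0 // lee_fin mulrC ler_pdivrMr.
Qed.

Lemma sqr_normcC (x : R[i]) : ((normc x) ^+ 2)%:C%C = `|x| ^+ 2.
Proof. by rewrite rmorphXn. Qed.

Lemma normc_ge0 (x : R[i]) : 0 <= normc x.
Proof. by case: x => x y; exact: sqrtr_ge0. Qed.

Definition nrm m (v : 'cV[R[i]]_m) : R :=
  Num.sqrt (\sum_(i < m) normc (v i 0) ^+ 2).

Lemma nrm_ge0 m (v : 'cV[R[i]]_m) : 0 <= nrm v.
Proof. exact: sqrtr_ge0. Qed.

Lemma sqr_nrm m (v : 'cV[R[i]]_m) : nrm v ^+ 2 = \sum_(i < m) normc (v i 0) ^+ 2.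
Proof. by rewrite sqr_sqrtr // sumr_ge0 // => i _; exact: sqr_ge0. Qed.

Lemma sqr_nrmC m (v : 'cV[R[i]]_m) : ((nrm v) ^+ 2)%:C%C = (v ^t* *m v) 0 0.
Proof.
rewrite sqr_nrm rmorph_sum mxE; apply: eq_bigr => i _.
by rewrite !mxE [LHS]sqr_normcC normCK mulrC.
Qed.

(** [dotmx] is a form on row vectors, hence the transposes; its triangle inequality gives [nrmD]. *)
Lemma nrm_sqrtC m (v : 'cV[R[i]]_m) : (nrm v)%:C%C = sqrtC (dotmx v^T v^T).
Proof.
rewrite dotmxE.
have -> : (v^T *m v^T ^t*) 0 0 = (v ^t* *m v) 0 0.
  by rewrite !mxE; apply: eq_bigr => i _; rewrite !mxE mulrC.
by rewrite -sqr_nrmC rmorphXn sqrCK // ler0c nrm_ge0.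
Qed.

Lemma nrmD m (u v : 'cV[R[i]]_m) : nrm (u + v) <= nrm u + nrm v.
Proof.
rewrite -lecR rmorphD /= !nrm_sqrtC linearD /=.
exact: (triangle_lerif (@dotmx R[i] m)).
Qed.

Lemma nrmZ m a (v : 'cV[R[i]]_m) : nrm (a *: v) = normc a * nrm v.
Proof.
apply/eqP; rewrite -(eqrXn2 (_ : 0 < 2)%N) ?mulr_ge0 ?nrm_ge0 //; last first.
  exact: normc_ge0.
rewrite exprMn !sqr_nrm mulr_sumr; apply/eqP/eq_bigr => i _.
by rewrite mxE ComplexField.Normc.normcM exprMn.
Qed.

Lemma nrm0 m : nrm (0 : 'cV[R[i]]_m) = 0.
Proof. by rewrite -(scale0r 0) nrmZ ComplexField.Normc.normc0 mul0r. Qed.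

Lemma normc_real (a : R) : 0 <= a -> normc a%:C%C = a.
Proof. by move=> a0; rewrite /normc /= expr0n addr0 sqrtr_sqr ger0_norm. Qed.

Lemma nrm_ge m (v : 'cV[R[i]]_m) i : normc (v i 0) <= nrm v.
Proof.
rewrite -(ler_pXn2r (_ : 0 < 2)%N) ?nnegrE ?nrm_ge0 //; last exact: normc_ge0.
rewrite sqr_nrm (bigD1 i) //= lerDl sumr_ge0 // => j _; exact: sqr_ge0.
Qed.

Lemma nrm_eq0 m (v : 'cV[R[i]]_m) : nrm v = 0 -> v = 0.
Proof.
move=> v0; apply/matrixP=> i j; rewrite (ord1 j) mxE.
apply: ComplexField.Normc.eq0_normc; apply/eqP; rewrite eq_le -{1}v0 nrm_ge.
exact: normc_ge0.
Qed.

Lemma nrm_sum m (I : finType) (F : I -> 'cV[R[i]]_m) :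
  nrm (\sum_i F i) <= \sum_i nrm (F i).
Proof.
apply: (big_ind2 (fun u r => nrm u <= r)) => //; first by rewrite nrm0.
by move=> u r v s ur vs; apply: le_trans (nrmD _ _) _; apply: lerD.
Qed.

(** [fine] loses nothing here: operator norms of matrices are finite, by [mxopnormE]. *)
Definition mxn p q (A : 'M[R[i]]_(p, q)) : R := fine (mxopnorm A).

Lemma mxopnorm_ge0 p q (A : 'M[R[i]]_(p, q)) : (0 <= mxopnorm A)%E.
Proof.
apply: (@le_trans _ _ (l2norm (A *m 0))); first by rewrite lee_fin nrm_ge0.
by apply: (@opnorm_ub _ _ _ (@l2norm R p) (mulmx A)); rewrite lee_fin -/(nrm _) nrm0 ler01.
Qed.

Lemma mxopnorm_le p q (A : 'M[R[i]]_(p, q)) c : 0 <= c ->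
  (forall v : 'cV_q, nrm (A *m v) <= c * nrm v) -> (mxopnorm A <= c%:E)%E.
Proof.
move=> c0 Ac; apply: opnorm_le => v; rewrite !lee_fin => v1.
by apply: le_trans (Ac v) _; rewrite ler_piMr.
Qed.

Lemma mxopnormE p q (A : 'M[R[i]]_(p, q)) : mxopnorm A = (mxn A)%:E.
Proof.
rewrite fineK // ge0_fin_numE ?mxopnorm_ge0 //.
(* Finiteness: the norm is at most the sum of the norms of the columns. *)
apply: (@le_lt_trans _ _ (\sum_j nrm (col j A))%:E); last exact: ltry.
apply: mxopnorm_le => [|v]; first by rewrite sumr_ge0 // => j _; exact: nrm_ge0.
have -> : A *m v = \sum_j v j 0 *: col j A.
  apply/matrixP=> i j; rewrite (ord1 j) summxE mxE; apply: eq_bigr => k _.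
  by rewrite !mxE mulrC.
apply: le_trans (nrm_sum _) _; rewrite mulr_suml; apply: ler_sum => j _.
by rewrite nrmZ mulrC; apply: ler_wpM2l; rewrite ?nrm_ge0 ?nrm_ge.
Qed.

Lemma mxn_ge0 p q (A : 'M[R[i]]_(p, q)) : 0 <= mxn A.
Proof. by rewrite -lee_fin -mxopnormE mxopnorm_ge0. Qed.

Lemma mxn_le p q (A : 'M[R[i]]_(p, q)) c : 0 <= c ->
  (forall v : 'cV_q, nrm (A *m v) <= c * nrm v) -> mxn A <= c.
Proof. by move=> c0 Ac; rewrite -lee_fin -mxopnormE mxopnorm_le. Qed.

Lemma mxn_ub p q (A : 'M[R[i]]_(p, q)) (v : 'cV_q) : nrm (A *m v) <= mxn A * nrm v.
Proof.
apply: (@opnorm_mul _ _ (@nrm q) (@nrm p) (mulmx A)) => //.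
- exact: nrm_ge0.
- exact: nrm_eq0.
- exact: nrm0.
- by move=> a x a0; rewrite nrmZ normc_real // ltW.
- by move=> a x a0; rewrite nrmZ normc_real // ltW.
- by rewrite -mxopnormE.
Qed.

Lemma mxnD p q (A B : 'M[R[i]]_(p, q)) : mxn (A + B) <= mxn A + mxn B.
Proof.
apply: mxn_le => [|v]; first by rewrite addr_ge0 ?mxn_ge0.
rewrite mulmxDl mulrDl; apply: le_trans (nrmD _ _) _.
by apply: lerD; exact: mxn_ub.
Qed.

Lemma mxnZ_le p q a (A : 'M[R[i]]_(p, q)) : mxn (a *: A) <= normc a * mxn A.
Proof.
have a0 : 0 <= normc a by exact: normc_ge0.
apply: mxn_le => [|v]; first by rewrite mulr_ge0 ?mxn_ge0.
by rewrite -scalemxAl nrmZ -mulrA ler_wpM2l ?mxn_ub.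
Qed.

Lemma mxn0 p q : mxn (0 : 'M[R[i]]_(p, q)) = 0.
Proof.
apply/eqP; rewrite eq_le mxn_ge0 andbT; apply: mxn_le => // v.
by rewrite mul0mx nrm0 mul0r.
Qed.

Lemma mxnZ p q a (A : 'M[R[i]]_(p, q)) : mxn (a *: A) = normc a * mxn A.
Proof.
have [->|a0] := eqVneq a 0.
  by rewrite scale0r mxn0 ComplexField.Normc.normc0 mul0r.
have na0 : 0 < normc a.
  rewrite lt_def normc_ge0 andbT; apply: contraNneq a0.
  by move/ComplexField.Normc.eq0_normc => ->.
apply/eqP; rewrite eq_le mxnZ_le /= -ler_pdivlMl //.
rewrite -ComplexField.Normc.normcV -{1}[A](scalerK a0) scalerA mulVf // scale1r.
by rewrite -{1}[A](scalerK a0) mxnZ_le.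
Qed.

Lemma mxn_eq0 p q (A : 'M[R[i]]_(p, q)) : mxn A = 0 -> A = 0.
Proof.
move=> A0; apply/matrixP=> i j.
have /nrm_eq0/matrixP/(_ i 0) : nrm (A *m delta_mx j (0 : 'I_1)) = 0.
  by apply/eqP; rewrite eq_le nrm_ge0 andbT -(mul0r (nrm (delta_mx j 0))) -A0 mxn_ub.
by rewrite -colE !mxE.
Qed.

(** Bare norm preservation passes to block-diagonal matrices without computing an adjoint. *)
Definition isometric p (U : 'M[R[i]]_p) := forall v : 'cV_p, nrm (U *m v) = nrm v.

Lemma unitary_isometric p (U : 'M[R[i]]_p) : U \is unitarymx -> isometric U.
Proof.
move=> Uu v; apply/eqP; rewrite -(eqrXn2 (_ : 0 < 2)%N) ?nrm_ge0 //.
apply/eqP/(fmorph_inj (real_complex R)); rewrite [LHS]sqr_nrmC [RHS]sqr_nrmC.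
rewrite trmx_mul map_mxM mulmxA -(mulmxA (v ^t*)).
move: Uu; rewrite -trmxC_unitary => /unitarymxP; rewrite trmxCK => ->.
by rewrite mulmx1.
Qed.

Lemma mxn_isometric p q (U : 'M[R[i]]_p) (A : 'M[R[i]]_(p, q)) (V : 'M[R[i]]_q) :
  isometric U -> isometric V -> mxn (U *m A *m V) <= mxn A.
Proof.
move=> Ui Vi; apply: mxn_le => [|v]; first exact: mxn_ge0.
by rewrite -!mulmxA Ui -(Vi v) mxn_ub.
Qed.

Lemma sqr_nrm_mxcol m (p_ : 'I_m -> nat) (v : forall i, 'cV[R[i]]_(p_ i)) :
  nrm (\mxcol_i v i) ^+ 2 = \sum_i nrm (v i) ^+ 2.
Proof.
apply: (fmorph_inj (real_complex R)); rewrite [LHS]sqr_nrmC tr_mxcol.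
have -> : (\mxrow_i (v i)^T) ^ Num.conj_op = \mxrow_i (v i)^t*.
  by apply/matrixP=> i j; rewrite !mxE.
rewrite mul_mxrow_mxcol summxE rmorph_sum; apply: eq_bigr => i _.
by rewrite -[LHS]sqr_nrmC.
Qed.

Lemma mxdiag_isometric m (p_ : 'I_m -> nat) (U : forall i, 'M[R[i]]_(p_ i)) :
  (forall i, isometric (U i)) -> isometric (\mxdiag_i U i).
Proof.
move=> Ui v; rewrite -(submxcolK v) mul_mxdiag_mxcol.
apply/eqP; rewrite -(eqrXn2 (_ : 0 < 2)%N) ?nrm_ge0 //.
by rewrite !sqr_nrm_mxcol; under eq_bigr do rewrite Ui.
Qed.

(** Identifies M_1(E) with E isometrically, which puts the norm of a map below its cb-norm. *)
Lemma mxn_mxblock11 p q (A : 'I_1 -> 'I_1 -> 'M[R[i]]_(p, q)) :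
  mxn (\mxblock_(i < 1, j < 1) A i j) = mxn (A 0 0).
Proof.
have n1 r (v : 'I_1 -> 'cV[R[i]]_r) : nrm (\mxcol_i v i) = nrm (v 0).
  apply/eqP; rewrite -(eqrXn2 (_ : 0 < 2)%N) ?nrm_ge0 //.
  by rewrite sqr_nrm_mxcol big_ord1.
have nA v : nrm ((\mxblock_(i < 1, j < 1) A i j) *m \mxcol_i v i) = nrm (A 0 0 *m v 0).
  rewrite mxblockEv mxcol_mul n1 mul_mxrow_mxcol big_ord1 //.
apply/eqP; rewrite eq_le; apply/andP; split.
  apply: mxn_le => [|v]; first exact: mxn_ge0.
  by rewrite -(submxcolK v) nA n1 mxn_ub.
apply: mxn_le => [|v]; first exact: mxn_ge0.
by have := mxn_ub (\mxblock_(i < 1, j < 1) A i j) (\mxcol_i v); rewrite nA n1.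
Qed.

End OperatorNorm.

(** * Unitary invariance and homogeneity *)

Section Unitaries.
Variable R : realType.
Notation C := R[i].

Lemma compound_unitary m n (U : 'M[C]_n) :
  U \is unitarymx -> compound m U \is unitarymx.
Proof.
move=> /unitarymxP Uu; apply/unitarymxP.
by rewrite tr_compound map_compound -compoundM Uu compound1.
Qed.

Lemma normc_eq1 (x : C) : x * x^* = 1 -> normc x = 1.
Proof.
move=> x1; apply/eqP; rewrite -(eqrXn2 (_ : 0 < 2)%N) ?normc_ge0 //.
by apply/eqP/(fmorph_inj (real_complex R)); rewrite [LHS]sqr_normcC normCK x1 expr1n rmorph1.
Qed.

Lemma det_unitary n (U : 'M[C]_n) : U \is unitarymx -> normc (\det U) = 1.
Proof.
move/unitarymxP/(congr1 determinant); rewrite det_mulmx det1 det_map_mx det_tr.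
exact: normc_eq1.
Qed.

Lemma perm_unitary n (s : 'S_n) : perm_mx s \is @unitarymx C n n.
Proof.
by apply/unitarymxP; rewrite tr_perm_mx map_perm_mx -perm_mxM mulgV perm_mx1.
Qed.

Lemma diag_unitary n (u : 'rV[C]_n) :
  (forall i, u 0 i * (u 0 i)^* = 1) -> diag_mx u \is unitarymx.
Proof.
move=> u1; apply/unitarymxP; rewrite tr_diag_mx map_diag_mx mulmx_diag.
by apply/matrixP=> i j; rewrite !mxE u1.
Qed.

(** If Q diagonalises M M^*, then Q M has orthogonal rows; W is Q M with its rows normalised, and
    [r] holds their lengths. *)
Lemma polar_decomposition n (M : 'M[C]_n) : M \in unitmx ->
  exists Q W (r : 'rV[R]_n), [/\ Q \is unitarymx, W \is unitarymx,
    forall i, 0 < r 0 i & M = Q ^t* *m diag_mx (map_mx (real_complex R) r) *m W].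
Proof.
move=> Mu; pose G := M *m M ^t*.
have Gh : G ^t* = G by rewrite trmx_mul map_mxM trmxCK.
have /orthomx_spectralP : G \is normalmx by apply/normalmxP; rewrite Gh.
set Q := spectralmx G; set sp := spectral_diag G => GE.
have Qu : Q \is unitarymx := spectral_unitarymx G.
pose Z := Q *m M.
have Zu : Z \in unitmx by rewrite unitmx_mul unitarymx_unit.
have ZZ : Z *m Z ^t* = diag_mx sp.
  rewrite trmx_mul map_mxM mulmxA -(mulmxA Q) -/G GE.
  by rewrite -invmx_unitary // !mulmxA mulmxV ?mul1mx ?mulmxK ?unitarymx_unit.
(* The rows of [Z] are orthogonal, so their lengths are the singular values. *)
pose r : 'rV[R]_n := \row_i nrm (row i Z)^T.
have spE i : sp 0 i = ((r 0 i) ^+ 2)%:C%C.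
  have /matrixP/(_ i i) := ZZ; rewrite mxE [in RHS]mxE eqxx mulr1n => <-.
  rewrite mxE [RHS]sqr_nrmC mxE; apply: eq_bigr => j _.
  by rewrite !mxE mulrC.
have r0 i : 0 < r 0 i.
  rewrite lt_def mxE nrm_ge0 andbT; apply/eqP => /nrm_eq0 Zi0.
  have : row i (Z *m invmx Z) = 0.
    by rewrite row_mul -[row i Z]trmxK Zi0 trmx0 mul0mx.
  rewrite mulmxV // => /matrixP/(_ 0 i); rewrite !mxE eqxx => /eqP.
  by rewrite oner_eq0.
pose D := diag_mx (map_mx (real_complex R) r).
pose D' := diag_mx (map_mx (real_complex R) (map_mx GRing.inv r)).
have DD' : D *m D' = 1%:M.
  apply/matrixP=> i j; rewrite mulmx_diag !mxE -rmorphM mulfV ?rmorph1 //.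
  by have := r0 i; rewrite mxE => /lt0r_neq0.
exists Q, (D' *m Z), r; split; [by [] | | by [] |]; last first.
  rewrite -mulmxA (mulmxA D) DD' mul1mx mulmxA -invmx_unitary //.
  by rewrite mulVmx ?mul1mx // unitarymx_unit.
apply/unitarymxP; rewrite trmx_mul map_mxM mulmxA -(mulmxA D') ZZ.
rewrite tr_diag_mx map_diag_mx !mulmx_diag; apply/matrixP=> i j; rewrite !mxE.
case: eqP => // _; rewrite !mulr1n spE mxE.
have := r0 i; rewrite mxE; set q := nrm _ => /lt0r_neq0 q0.
rewrite [X in _ * X](conjc_real q^-1) -!rmorphM expr2 mulrA mulVf // mul1r.
by rewrite mulfV // rmorph1.
Qed.

(** [M + e] is singular only if [- e] is a root of the characteristic polynomial, and the distinct
    values d, d/2, d/3, ... outnumber the roots. *)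
Lemma shifted_unit n (M : 'M[C]_n) (d : R) : 0 < d ->
  exists2 e : R, 0 < e <= d & M + (e%:C%C)%:M \in unitmx.
Proof.
move=> d0; pose e k : R := d / k.+1%:R.
pose s := [seq - (e k)%:C%C | k <- iota 0 (size (char_poly M))].
have e_inj : injective e.
  move=> k l /(mulfI (lt0r_neq0 d0))/invr_inj/eqP.
  by rewrite eqr_nat eqSS => /eqP.
have : ~~ all (root (char_poly M)) s.
  apply/negP => rs; have us : uniq s.
    by rewrite map_inj_uniq ?iota_uniq // => k l /oppr_inj/complexI/e_inj.
  have := max_poly_roots (monic_neq0 (char_poly_monic M)) rs us.
  by rewrite size_map size_iota ltnn.
move/allPn => [_ /mapP[k _ ->] nr]; exists (e k).
  rewrite divr_gt0 ?ltr0n //= ler_pdivrMr ?ltr0n // ler_peMr ?(ltW d0) //.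
  by rewrite ler1n.
move: nr; rewrite -eigenvalue_root_char /eigenvalue negbK kermx_eq0.
by rewrite -row_free_unit raddfN opprK.
Qed.

Lemma unit_average (t : R) : 0 <= t <= 1 ->
  exists2 u : C, u * u^* = 1 & t%:C%C = 2^-1 * (u + u^*).
Proof.
move=> /andP[t0 t1].
have s0 : 0 <= 1 - t ^+ 2 by rewrite subr_ge0 expr_le1.
pose u : C := (t +i* Num.sqrt (1 - t ^+ 2))%C; exists u.
  rewrite -normCK; apply/eqP; rewrite normc_def /= sqr_sqrtr //.
  by rewrite addrC subrK sqrtr1 expr1n.
have -> : u + u^* = 2 * t%:C%C.
  by apply/eqP; rewrite mulr_natl mulr2n eq_complex /= subrr addr0 !eqxx.
by rewrite mulKf // pnatr_eq0.
Qed.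

End Unitaries.

(** * Amplified norms of the maps sending b(h) to b(h M) *)

Section Homogeneity.
Variables (R : realType) (a b : nat).
Notation n := (a + (1 + b))%N.
Notation C := R[i].
Implicit Types (h : 'rV[C]_n) (U M : 'M[C]_n).

Definition amp m (F : 'I_m -> 'I_m -> 'rV[C]_n) :=
  \mxblock_(i < m, j < m) bmx (F i j).

Lemma ampD m (F G : 'I_m -> 'I_m -> 'rV[C]_n) :
  amp (fun i j => F i j + G i j) = amp F + amp G.
Proof. by rewrite -mxblockD; apply: eq_mxblock => i j; rewrite linearD. Qed.

Lemma ampZ m c (F : 'I_m -> 'I_m -> 'rV[C]_n) :
  amp (fun i j => c *: F i j) = c *: amp F.
Proof.
rewrite -mul_scalar_mx -mxdiagZ mul_mxdiag_mxblock.
by apply: eq_mxblock => i j; rewrite mul_scalar_mx linearZ.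
Qed.

(** Covariance at h U and the adjoint of [U]. As [A], [B] and [c] do not depend on [h], one choice
    serves all blocks of an amplification. *)
Lemma bmx_unitary U : U \is unitarymx ->
  exists A B (c : C), [/\ isometric A, isometric B, normc c = 1 &
    forall h, c *: bmx (h *m U) = A *m bmx h *m B].
Proof.
move=> Uu; have Uu' : U ^t* \is unitarymx by rewrite trmxC_unitary.
exists (compound b (U ^t*)), (compound a (U ^t*))^T, (\det (U ^t*)); split.
- exact/unitary_isometric/compound_unitary.
- by apply: unitary_isometric; rewrite trmx_unitary compound_unitary.
- exact: det_unitary.
move=> h; rewrite bmx_covariant.
rewrite (mulmxtVK h Uu).
reflexivity.
Qed.

Lemma amp_unitary m (F : 'I_m -> 'I_m -> 'rV[C]_n) U : U \is unitarymx ->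
  mxn (amp (fun i j => F i j *m U)) <= mxn (amp F).
Proof.
case/bmx_unitary=> A [B [c [Ai Bi c1 FU]]].
rewrite -[leLHS]mul1r -c1 -mxnZ -ampZ.
have -> : amp (fun i j => c *: (F i j *m U)) =
    \mxdiag_(i < m) A *m amp F *m \mxdiag_(i < m) B.
  rewrite mul_mxdiag_mxblock mul_mxblock_mxdiag; apply: eq_mxblock => i j.
  by rewrite linearZ /= FU.
by apply: mxn_isometric; exact: mxdiag_isometric.
Qed.

Lemma mxn_bmx_unitary h U : U \is unitarymx ->
  mxn (bmx (h *m U)) <= mxn (bmx h).
Proof.
case/bmx_unitary=> A [B [c [Ai Bi c1 FU]]].
by rewrite -[leLHS]mul1r -c1 -mxnZ FU mxn_isometric.
Qed.

(** Permutation matrices are unitary, so all b_i have the same norm. This disposes of the case where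
    one of them vanishes. *)
Lemma bmx_delta_eq0 i : bmx (delta_mx 0 i : 'rV[C]_n) = 0 ->
  forall h, bmx h = 0.
Proof.
move=> bi0 h; rewrite (@bmxE _ a b) big1 // => j _.
suff -> : bmx (delta_mx 0 j : 'rV[C]_n) = 0 by rewrite scaler0.
apply: mxn_eq0; apply/eqP; rewrite eq_le mxn_ge0 andbT.
have := mxn_bmx_unitary (delta_mx 0 i) (perm_unitary R (tperm i j)).
have -> : delta_mx 0 i *m perm_mx (tperm i j) = delta_mx 0 j :> 'rV[C]_n.
  by rewrite -rowE; apply/rowP=> k; rewrite !mxE tpermL eqxx eq_sym.
by rewrite bi0 mxn0.
Qed.

Lemma amp_bounded_unit m (F : 'I_m -> 'I_m -> 'rV[C]_n) M (c : R) : 0 < c ->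
    M \in unitmx -> (forall i, bmx (delta_mx 0 i : 'rV[C]_n) != 0) ->
    (forall h, mxn (bmx (h *m M))
       <= c * mxn (bmx h)) ->
  mxn (amp (fun i j => F i j *m M)) <= c * mxn (amp F).
Proof.
move=> c0 Mu b0 Mc; have [Q [W [r [Qu Wu r0 ME]]]] := polar_decomposition Mu.
have Qu' : Q ^t* \is unitarymx by rewrite trmxC_unitary.
have Wu' : W ^t* \is unitarymx by rewrite trmxC_unitary.
(* Test the bound on e_i Q: one has e_i Q M W^* = r_i e_i, and neither Q nor W^* increases norms. *)
have rc i : r 0 i <= c.
  have kpos : 0 < mxn (bmx (delta_mx 0 i : 'rV[C]_n)).
    by rewrite lt_def mxn_ge0 andbT; apply: contra (b0 i) => /eqP/mxn_eq0->.
  rewrite -(ler_pM2r kpos) -{1}(normc_real (ltW (r0 i))) -mxnZ -linearZ.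
  have -> : (r 0 i)%:C%C *: (delta_mx 0 i : 'rV[C]_n) = delta_mx 0 i *m Q *m M *m W ^t*.
    rewrite ME !mulmxA mulmxtVK // mulmxtVK // -rowE.
    apply/rowP => j; rewrite !mxE eqxx /= eq_sym mulr_natr; case: eqP => // ->.
  apply: le_trans (mxn_bmx_unitary _ Wu') _; apply: le_trans (Mc _) _.
  by apply: ler_wpM2l; [exact: ltW|exact: (mxn_bmx_unitary _ Qu)].
have /boolp.choice[u uP] : forall i, exists u : C, u * u^* = 1 /\
    (r 0 i / c)%:C%C = 2^-1 * (u + u^*).
  move=> i; have [|u u1 ru] := @unit_average R (r 0 i / c); last by exists u.
  by apply/andP; split; [rewrite divr_ge0 // ltW|rewrite ler_pdivrMr // mul1r].
pose Phi := diag_mx (\row_i u i).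
have Phiu : Phi \is unitarymx by apply: diag_unitary => i; rewrite mxE (uP i).1.
pose U1 := Q ^t* *m Phi *m W; pose U2 := Q ^t* *m Phi ^t* *m W.
have Phiu' : Phi ^t* \is unitarymx by rewrite trmxC_unitary.
have U1u : U1 \is unitarymx := mul_unitarymx (mul_unitarymx Qu' Phiu) Wu.
have U2u : U2 \is unitarymx := mul_unitarymx (mul_unitarymx Qu' Phiu') Wu.
(* D / c is the average of [Phi] and its adjoint, so M is c times the average of the unitaries [U1]
   and [U2]. *)
have MU : M = (c / 2)%:C%C *: (U1 + U2).
  rewrite ME -mulmxDl -mulmxDr scalemxAl scalemxAr; congr (_ *m _ *m _).
  rewrite tr_diag_mx map_diag_mx; apply/matrixP=> i j; rewrite !mxE.
  rewrite -mulrnDl mulrnAr; congr (_ *+ _).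
  rewrite -[LHS](_ : (c * (r 0 i / c))%:C%C = _); last by rewrite mulrC divfK ?gt_eqF.
  rewrite [LHS]rmorphM [X in _ * X](uP i).2 mulrA; congr (_ * _).
  by rewrite [RHS]rmorphM fmorphV rmorph_nat.
have -> : amp (fun i j => F i j *m M) = (c / 2)%:C%C *:
   (amp (fun i j => F i j *m U1) + amp (fun i j => F i j *m U2)).
  rewrite -ampD -ampZ; apply: eq_mxblock => i j.
  by rewrite -mulmxDr scalemxAr -MU.
rewrite mxnZ normc_real; last by rewrite divr_ge0 // ltW.
rewrite -mulrA ler_pM2l // ler_pdivrMl ?ltr0n // mulr_natl mulr2n.
apply: le_trans (mxnD _ _) _.
exact: (lerD (amp_unitary F U1u) (amp_unitary F U2u)).
Qed.

Lemma amp_bounded m (F : 'I_m -> 'I_m -> 'rV[C]_n) M (c : R) : 0 <= c ->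
    (forall h, mxn (bmx (h *m M))
       <= c * mxn (bmx h)) ->
  mxn (amp (fun i j => F i j *m M)) <= c * mxn (amp F).
Proof.
move=> c0 Mc.
have [[i /bmx_delta_eq0 b0]|b0] := pselect (exists i,
    bmx (delta_mx 0 i : 'rV[C]_n) = 0).
  have -> : amp (fun i j => F i j *m M) = 0.
    by rewrite -[RHS]mxblock0; apply: eq_mxblock => k l; rewrite b0.
  by rewrite mxn0 mulr_ge0 ?mxn_ge0.
set N := (X in _ <= c * X); apply/ler_addgt0Pr => e e0.
(* A shift by d costs d N in the constant c + d, and d N again when it is undone. Taking d <= e / (2
   N + 1) keeps the total within e, and the 1 keeps the divisor positive. *)
have N1 : 0 < 2 * N + 1 by rewrite ltr_wpDl ?ltr01 // mulr_ge0 ?mxn_ge0.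
have [d /andP[d0 dle] Md] := shifted_unit M (divr_gt0 e0 N1).
have Mc' h : mxn (bmx (h *m (M + (d%:C%C)%:M)))
    <= (c + d) * mxn (bmx h).
  rewrite mulmxDr linearD mul_mx_scalar linearZ mulrDl.
  by apply: le_trans (mxnD _ _) _; rewrite mxnZ (normc_real (ltW d0)) lerD2r Mc.
have := @amp_bounded_unit m F _ (c + d) _ Md _ Mc'.
rewrite ltr_wpDl // => /(_ isT) bnd.
have -> : amp (fun i j => F i j *m M) = amp (fun i j => F i j *m (M + (d%:C%C)%:M)) +
    (- d%:C%C) *: amp F.
  rewrite -ampZ -ampD; apply: eq_mxblock => i j.
  by rewrite mulmxDr mul_mx_scalar scaleNr addrK.
apply: le_trans (mxnD _ _) _; rewrite mxnZ normcN (normc_real (ltW d0)).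
apply: (@le_trans _ _ ((c + d) * N + d * N)).
  by rewrite lerD2r bnd // => i; apply/eqP => bi; apply: b0; exists i.
rewrite mulrDl -addrA lerD2l -mulr2n -mulr_natl mulrCA.
move: dle; rewrite ler_pdivlMr // mulrDr mulr1 => /(le_trans _); apply.
by rewrite lerDl ltW.
Qed.
End Homogeneity.

(** * From coefficient vectors to linear maps on the subspace *)

Lemma homogeneous_bmx (R : realType) a b
    (E : {vspace 'M[R[i]]_('C(a + (1 + b), b), 'C(a + (1 + b), a))}) :
    (forall h, bmx h \in E) -> (forall y, y \in E -> exists h, y = bmx h) ->
  homogeneous E.
Proof.
move=> bE Eb T Tbnd.
pose tau := fine (mapnorm T).
have subE x : subnorm (E := E) x = (mxn (vsval x))%:E by exact: mxopnormE.
have subF : @subnorm R _ _ E = fun x => (mxn (vsval x))%:E by apply/funext.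
have ampE m (x : 'M[subvs_of E]_m) : ampnorm x =
  (mxn (\mxblock_(i < m, j < m) vsval (x i j)))%:E by exact: mxopnormE.
have tau0 : (0 <= mapnorm T)%E.
  apply: (@le_trans _ _ (subnorm (T 0))); first by rewrite subE lee_fin mxn_ge0.
  by apply: opnorm_ub; rewrite subE linear0 mxn0 lee_fin ler01.
have tauE : mapnorm T = tau%:E by rewrite fineK // ge0_fin_numE.
have Ttau x : mxn (vsval (T x)) <= tau * mxn (vsval x).
  apply: (@opnorm_mul _ _ _ (fun x : subvs_of E => mxn (vsval x))
    (fun x : subvs_of E => mxn (vsval x)) T).
  - by move=> y; exact: mxn_ge0.
  - by move=> y /mxn_eq0 y0; apply: val_inj; rewrite -[RHS]/(vsval 0) linear0.
  - by rewrite linear0 mxn0.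
  - by move=> c y c0; rewrite linearZ mxnZ normc_real // ltW.
  - by move=> c y c0; rewrite linearZ mxnZ normc_real // ltW.
  - by rewrite -tauE /mapnorm subF.
pose bs h : subvs_of E := Subvs (bE h).
have /boolp.choice[hf hfE] : forall y : subvs_of E, exists h, vsval y = bmx h.
  by move=> y; apply/Eb/subvsP.
(* Row i is a chosen coefficient vector of T(b_i); by linearity T(b(h)) = b(h M) for any such
   choice. *)
pose M := \matrix_i hf (T (bs (delta_mx 0 i))).
have TM h : vsval (T (bs h)) = bmx (h *m M).
  have -> : bs h = \sum_i h 0 i *: bs (delta_mx 0 i).
    by apply: val_inj; rewrite /= linear_sum /= bmxE.
  rewrite mulmx_sum_row !linear_sum; apply: eq_bigr => i _.
  by rewrite !linearZ /= hfE rowK.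
have Mtau h : mxn (bmx (h *m M)) <= tau * mxn (bmx h).
  by rewrite -TM Ttau.
have fine0 : 0 <= tau by rewrite fine_ge0.
have cb_le : (cbnorm T <= mapnorm T)%E.
  apply/ereal_supP => _ [m _ <-]; apply: opnorm_le => x.
  rewrite tauE !ampE => x1; rewrite lee_fin in x1; rewrite lee_fin.
  pose F i j := hf (x i j).
  have xF : \mxblock_(i < m, j < m) vsval (x i j) = amp F.
    by apply: eq_mxblock => i j; rewrite hfE.
  have TxF : \mxblock_(i < m, j < m) vsval (map_mx T x i j) =
      amp (fun i j => F i j *m M).
    apply: eq_mxblock => i j; rewrite mxE -TM; congr (vsval (T _)).
    by apply: val_inj; rewrite /= hfE.
  rewrite TxF; rewrite xF in x1.
  by apply: le_trans (amp_bounded F fine0 Mtau) _; rewrite ler_piMr.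
(* The level m = 1 of the supremum already gives the norm of [T]. *)
have le_cb : (mapnorm T <= cbnorm T)%E.
  apply: opnorm_le => x x1.
  have amp1 y : ampnorm (const_mx y : 'M[subvs_of E]_1) = subnorm y.
    by rewrite ampE mxn_mxblock11 mxE subE.
  rewrite -amp1 -map_const_mx.
  apply: (@le_trans _ _ (opnorm (@ampnorm R _ _ E 1) (@ampnorm R _ _ E 1) (map_mx T))).
    by apply: opnorm_ub; rewrite amp1.
  by apply: ereal_sup_ubound; exists 1%N.
have cbE : cbnorm T = mapnorm T by apply/eqP; rewrite eq_le cb_le le_cb.
by split=> //; rewrite /completely_bounded cbE.
Qed.

(* The index sizes are variables here, unlike the [n - k] and [k.-1] of [Hspace],
   so that [n] can be replaced by [a + (1 + b)]. *)
Lemma homogeneous_span (R : realType) n a b : n = (a + (1 + b))%N ->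
  homogeneous <<[seq (\sum_(J < 'C(n, b)) \sum_(I < 'C(n, a)
      | ((lexset n a I :&: lexset n b J)%SET == finset.set0) &&
        ((~: (lexset n a I :|: lexset n b J))%SET == [set i]%SET))
    eps R (lexset n a I) i (lexset n b J) *: delta_mx J I)%R | i <- enum 'I_n]>>%VS.
Proof.
move=> ->; under eq_map do rewrite -bmx_delta; set s := map _ _.
apply: homogeneous_bmx => [h|y].
  rewrite bmxE memv_suml // => i _; apply/memvZ/memv_span/map_f.
  by rewrite mem_enum.
(* An element of the span is a combination of generators, and the values of [bmx] are closed under
   sums and multiples. *)
rewrite -[s]/(val (in_tuple s)) => /coord_span ->.
apply: (big_ind (fun y => exists h, y = bmx h)).
- by exists 0; rewrite linear0.
- by move=> _ _ [h ->] [g ->]; exists (h + g); rewrite linearD.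
move=> k _; have /mapP[i _ ->] : (in_tuple s)`_k \in s by rewrite mem_nth.
by exists (coord (in_tuple s) k y *: delta_mx 0 i); rewrite linearZ.
Qed.

Theorem theorem1 (R : realType) (n k : nat) (hn : (1 <= n)%N)
    (hk : (1 <= k)%N) (hkn : (k <= n)%N) :
  homogeneous (Hspace R n k).
Proof.
(* Here a = k - 1 and b = n - k. *)
by apply: homogeneous_span; rewrite addnA addn1 prednK // subnKC.
Qed.
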